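(* Let $p$ be an odd prime, $0<\nu\le\eta\le2\nu$, $1\le r\le\nu$, $I:=\mathbb{Z}/p^{r}\mathbb{Z}$. Let $a=1+kp$ with $0<k<p^{r-1}$, and write $k=p^{u}v$ with $p\nmid v$. Let $0\le b<p^{r}$ be such that either $b=0$, or $b=p^{s}d$ with $p\nmid d$ and $s<r\le2s$. Let $A:=a\operatorname{Id}$ and $B:=b\operatorname{Id}$ in $\operatorname{End}(I)$, and let $h\diamond y:=a^{h}y$ and $y\prec h:=hby$ for $h\in H$, $y\in I$. Define $$t_1:=\begin{cases}u+1&\text{if }b=0,\\ \min\{u+1,s\}&\text{if }b\ne0,\end{cases}\qquad t_2:=\begin{cases}u+1&\text{if }b=0,\\ t_1&\text{if }b\ne0,\ s\ne u+1,\\ s+\max\{j:p^{j}\mid(v+d+p^{s}vd)\}&\text{if }b\ne0,\ s=u+1.\end{cases}$$ Then $$\operatorname{H}^2_{\diamond,\prec}(H,I)\simeq\frac{\mathbb{Z}/p^{r}\mathbb{Z}}{p^{t_2}(\mathbb{Z}/p^{r}\mathbb{Z})}\oplus p^{r-t_1}(\mathbb{Z}/p^{r}\mathbb{Z}),$$ and a complete family $(\alpha_1(\gamma),f_{f_0,\gamma})$ of representatives of 2-cocycles modulo coboundaries is parametrized by the pairs $(f_0,\gamma)$ in the subset $\{(z_1,p^{r-t_1}z_2):0\le z_1<p^{t_2}\text{ and }0\le z_2<p^{t_1}\}$ of $I\times I$.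
   Context: $H=\mathbb{Z}/p^{\eta}\mathbb{Z}$ with its usual sum, the linear cycle set operation $i\cdot j:=(1-p^{\nu}i)j$, and the operation $i\times j:=i+j+p^{\nu}ij$, for which $H$ is a cyclic group generated by $1$, with powers $1^{\times k}=k+\binom{k}{2}p^{\nu}$. With the data of the claim, $A^{p^{\nu}}=\operatorname{Id}$, $p^{\nu}I=0$, and $1^{\times k}\diamond y=A^{k}y$, $y\prec h=hBy$. A 2-cocycle is a pair $(\beta,f)$ of maps $H\times H\to I$, both vanishing when some argument is $0$, with $\beta$ symmetric, such that for all $x,y,z\in H$: $\beta(y,z)-\beta(x+y,z)+\beta(x,y+z)-\beta(x,y)=0$; $f(x,y+z)-f(x,y)-f(x,z)=x\diamond\beta(y,z)-\beta(x\cdot y,x\cdot z)$; $f(x+y,z)=(x\cdot y)\diamond f(x,z)+f(x\cdot y,x\cdot z)+\bigl((x\cdot y)\diamond f(x,y)\bigr)\prec\bigl((x+y)\cdot z\bigr)+\bigl((x+y)\diamond\beta(x,y)\bigr)\prec\bigl((x+y)\cdot z\bigr)$. It is a coboundary if there is $t\colon H\to I$ with $t(0)=0$ such that $\beta(x,y)=t(x)-t(x+y)+t(y)$ and $f(x,y)=t(x\cdot y)-x\diamond t(y)-(x\diamond t(x))\prec(x\cdot y)$. $\operatorname{H}^2_{\diamond,\prec}(H,I)$ is the group of 2-cocycles modulo coboundaries. For $\gamma\in I$ and integers $0\le i,j<p^{\eta}$: $\alpha_1(\gamma)(i,j):=\gamma$ if $i+j\ge p^{\eta}$, and $0$ otherwise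 (a map $H\times H\to I$). For $f_0,\gamma\in I$ with $p^{\eta}f_0=(p^{\eta}-p^{\nu}+1)\gamma-A\gamma$, put $\Gamma(\gamma,h):=A\alpha_1(\gamma)(h,1)-\alpha_1(\gamma)(1\cdot h,1\cdot1)$; the map $\hat f(n):=nf_0+\sum_{h=0}^{n-1}\Gamma(\gamma,h)$ ($n\in\mathbb{N}_0$) is $p^{\eta}$-periodic and induces $\tilde f\colon H\to I$. Put $b_l:=l+\binom{l+1}{2}p^{\nu}\in H$ and define $$f_{f_0,\gamma}(1^{\times m},c):=\sum_{j=0}^{m-1}A^{m-1-j}\tilde f(j\cdot c)+(m\cdot c)B\sum_{l=0}^{m-1}A^{l}\tilde f(b_l)\qquad(0\le m<p^{\eta},\ c\in H).$$ A set $\Lambda\subseteq I\times I$ parametrizes a complete family of representatives of 2-cocycles modulo coboundaries if $(\alpha_1(\gamma),f_{f_0,\gamma})$ is a 2-cocycle for every $(f_0,\gamma)\in\Lambda$ and each class in $\operatorname{H}^2_{\diamond,\prec}(H,I)$ contains $(\alpha_1(\gamma),f_{f_0,\gamma})$ for exactly one $(f_0,\gamma)\in\Lambda$. *)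

(* Defs.v *)
From HB Require Import structures.
From mathcomp Require Import all_boot all_order all_fingroup all_algebra.

Set Implicit Arguments.
Unset Strict Implicit.
Unset Printing Implicit Defensive.

Import GRing.Theory.
Local Open Scope ring_scope.

(* Registers the missing finZmodType instances on {ffun _ -> _} and on products,
   hence their (additive) finGroupType structures. *)
HB.saturate finfun_of.
HB.saturate prod.

Section Homothety.
Variable I : finZmodType.

Definition homothety (n : nat) (y : I) : I := y *+ n.

Lemma homothety_is_zmod_morphism n : zmod_morphism (homothety n).
Proof. by move=> x y; apply: mulrnBl. Qed.

HB.instance Definition _ n :=
  GRing.isZmodMorphism.Build I I (homothety n) (homothety_is_zmod_morphism n).

Definition multiples (n : nat) : {set I} := [set y *+ n | y : I].

Lemma multiples_group_set n : group_set (multiples n).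
Proof.
apply/group_setP; split; first by apply/imsetP; exists 0; rewrite // mul0rn.
move=> _ _ /imsetP[y _ ->] /imsetP[z _ ->].
by apply/imsetP; exists (y + z); rewrite // mulrnDl.
Qed.

Canonical multiples_group n := Group (multiples_group_set n).

End Homothety.

Section SecondCohomology.
Variables (H I : finZmodType) (cdot : H -> H -> H).
(* Both operators take the element of H first, so that their type records
   additivity in I: dia h y is h ⋄ y, and prec h y is y ≺ h. *)
Variables (dia prec : H -> {additive I -> I}).

Local Notation "x · y" := (cdot x y) (at level 40, left associativity).
Local Notation "x ⋄ y" := (dia x y) (at level 40, left associativity).
Local Notation "y ≺ x" := (prec x y) (at level 40, left associativity).

Definition cochains : predArgType :=
  ({ffun H * H -> I} * {ffun H * H -> I})%type.
HB.instance Definition _ := FinRing.Zmodule.on cochains.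

Definition is_2cocycle (c : cochains) : bool :=
  let beta x y := c.1 (x, y) in
  let f x y := c.2 (x, y) in
  [&& [forall x, [&& beta x 0 == 0, beta 0 x == 0, f x 0 == 0 & f 0 x == 0]],
      [forall x, forall y, beta x y == beta y x],
      [forall x, forall y, forall z,
         beta y z - beta (x + y) z + beta x (y + z) - beta x y == 0],
      [forall x, forall y, forall z,
         f x (y + z) - f x y - f x z ==
         x ⋄ beta y z - beta (x · y) (x · z)]
    & [forall x, forall y, forall z,
         f (x + y) z ==
         (x · y) ⋄ f x z + f (x · y) (x · z)
         + ((x · y) ⋄ f x y) ≺ ((x + y) · z)
         + ((x + y) ⋄ beta x y) ≺ ((x + y) · z)]].

Definition is_coboundary (c : cochains) : bool :=
  [exists t : {ffun H -> I},
    (t 0 == 0) &&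
    [forall x, forall y,
       (c.1 (x, y) == t x - t (x + y) + t y) &&
       (c.2 (x, y) == t (x · y) - x ⋄ t y - (x ⋄ t x) ≺ (x · y))]].

Definition cocycles : {set cochains} := [set c | is_2cocycle c].
Definition coboundaries : {set cochains} := [set c | is_coboundary c].

Lemma cocycles_group_set : group_set cocycles.
Proof.
apply/group_setP; split.
  rewrite inE /is_2cocycle /=; apply/and5P; split.
  - by apply/forallP=> x; rewrite !ffunE !eqxx.
  - by apply/forallP=> x; apply/forallP=> y; rewrite !ffunE.
  - by do 3![apply/forallP=> ?]; rewrite !ffunE !(subr0, addr0).
  - by do 3![apply/forallP=> ?]; rewrite !ffunE !(raddf0, subr0, addr0).
  - by do 3![apply/forallP=> ?]; rewrite !ffunE !(raddf0, subr0, addr0).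
move=> c c'.
have P1 xy : (c * c')%g.1 xy = c.1 xy + c'.1 xy by rewrite ffunE.
have P2 xy : (c * c')%g.2 xy = c.2 xy + c'.2 xy by rewrite ffunE.
rewrite !inE /is_2cocycle /=.
case/and5P=> [/forallP n1 /forallP s1 /forallP b1 /forallP f1 /forallP g1].
case/and5P=> [/forallP n2 /forallP s2 /forallP b2 /forallP f2 /forallP g2].
apply/and5P; split.
- apply/forallP=> x; rewrite !(P1, P2).
  have /and4P[/eqP-> /eqP-> /eqP-> /eqP->] := n1 x.
  have /and4P[/eqP-> /eqP-> /eqP-> /eqP->] := n2 x.
  by rewrite !addr0 eqxx.
- apply/forallP=> x; apply/forallP=> y; rewrite !(P1, P2).
  by rewrite (eqP (forallP (s1 x) y)) (eqP (forallP (s2 x) y)).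
- apply/forallP=> x; apply/forallP=> y; apply/forallP=> z; rewrite !(P1, P2).
  have /eqP e1 := forallP (forallP (b1 x) y) z.
  have /eqP e2 := forallP (forallP (b2 x) y) z.
  rewrite !opprD (addrACA (c.1 (y, z))) (addrACA (c.1 (y, z) - _)).
  by rewrite (addrACA (c.1 (y, z) - _ + _)) e1 e2 addr0.
- apply/forallP=> x; apply/forallP=> y; apply/forallP=> z; rewrite !(P1, P2).
  have /eqP e1 := forallP (forallP (f1 x) y) z.
  have /eqP e2 := forallP (forallP (f2 x) y) z.
  rewrite (raddfD (dia x)) !opprD (addrACA (c.2 (x, y + z))).
  rewrite (addrACA (c.2 (x, y + z) - _)) e1 e2.
  by rewrite /= addrACA.
- apply/forallP=> x; apply/forallP=> y; apply/forallP=> z; rewrite !(P1, P2).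
  have /eqP e1 := forallP (forallP (g1 x) y) z.
  have /eqP e2 := forallP (forallP (g2 x) y) z.
  rewrite e1 e2 !raddfD /=.
  set A1 := dia _ (c.2 _); set A2 := dia _ (c'.2 _).
  set B1 := c.2 _; set B2 := c'.2 _.
  rewrite (addrACA A1) (addrACA (A1 + B1)) (addrACA (A1 + B1 + _)).
  by rewrite eqxx.
Qed.

Lemma coboundaries_group_set : group_set coboundaries.
Proof.
apply/group_setP; split.
  rewrite inE; apply/existsP; exists 0; rewrite ffunE eqxx /=.
  do 2![apply/forallP=> ?]; rewrite !ffunE !raddf0 !addr0.
  by rewrite !eqxx.
move=> c c'.
have P1 xy : (c * c')%g.1 xy = c.1 xy + c'.1 xy by rewrite ffunE.
have P2 xy : (c * c')%g.2 xy = c.2 xy + c'.2 xy by rewrite ffunE.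
rewrite !inE => /existsP[t /andP[/eqP t0 /forallP tc]].
move=> /existsP[t' /andP[/eqP t'0 /forallP tc']].
apply/existsP; exists (t + t'); rewrite ffunE t0 t'0 addr0 eqxx /=.
apply/forallP=> x; apply/forallP=> y; rewrite P1 P2 !ffunE.
have /andP[/eqP-> /eqP->] := forallP (tc x) y.
have /andP[/eqP-> /eqP->] := forallP (tc' x) y.
rewrite !raddfD /=; apply/andP; split; apply/eqP.
- by rewrite (addrACA (t x)) (addrACA (t x - _)).
- by rewrite (addrACA (t (x · y))) (addrACA (t (x · y) - _)).
Qed.

Canonical cocycles_group := Group cocycles_group_set.
Canonical coboundaries_group := Group coboundaries_group_set.

Definition H2 : {set coset_of coboundaries} := (cocycles / coboundaries)%g.
Canonical H2_group := [group of H2].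

End SecondCohomology.

Section CyclicData.
Variables (p nu eta : nat).
Local Notation H := 'Z_(p ^ eta).

(* The linear cycle set operation i · j on H. *)
Definition lcs_dot (i j : H) : H := (1 - (p ^ nu)%:R * i) * j.
Definition lcs_times (i j : H) : H := i + j + (p ^ nu)%:R * i * j.

(* The k-th power of 1 for lcs_times, whose neutral element is 0. *)
Definition one_pow (k : nat) : H := iter k (lcs_times^~ 1) 0.

Variables (I : finZmodType) (A B : {additive I -> I}).

Definition alpha1 (gamma : I) : {ffun H * H -> I} :=
  [ffun ij : H * H => if (p ^ eta <= (ij.1 : nat) + (ij.2 : nat))%N then gamma else 0].

(* The condition under which f_{f0,gamma} is defined: fhat below is then
   (p ^ eta)-periodic. *)
Definition admissible (f0 gamma : I) : bool :=
  f0 *+ (p ^ eta) == gamma *+ (p ^ eta - p ^ nu + 1) - A gamma.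

Definition Gam (gamma : I) (h : H) : I :=
  A (alpha1 gamma (h, 1)) - alpha1 gamma (lcs_dot 1 h, lcs_dot 1 1).

Definition fhat (f0 gamma : I) (n : nat) : I :=
  f0 *+ n + \sum_(h < n) Gam gamma h%:R.

Definition ftilde (f0 gamma : I) (h : H) : I := fhat f0 gamma h.

Definition b_idx (l : nat) : H := (l + 'C(l.+1, 2) * p ^ nu)%:R.

Definition frep_pow (f0 gamma : I) (m : nat) (c : H) : I :=
  \sum_(j < m) iter (m - 1 - j) A (ftilde f0 gamma (lcs_dot j%:R c))
  + B (\sum_(l < m) iter l A (ftilde f0 gamma (b_idx l))) *+ lcs_dot m%:R c.

(* For p odd and eta <= 2 * nu, each element of H is one_pow m for exactly one
   m < p ^ eta, so that the default value is never taken. *)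
Definition frep (f0 gamma : I) : {ffun H * H -> I} :=
  [ffun xc : H * H => if [pick m : 'I_(p ^ eta) | one_pow m == xc.1] is Some m
              then frep_pow f0 gamma m xc.2 else 0 : I].

Definition complete_representatives
    (dia prec : H -> {additive I -> I}) (Lambda : {set I * I}) : Prop :=
  (forall f0 gamma : I, (f0, gamma) \in Lambda ->
     admissible f0 gamma /\
     is_2cocycle lcs_dot dia prec (alpha1 gamma, frep f0 gamma)) /\
  (forall C : coset_of (coboundaries lcs_dot dia prec),
     C \in H2 lcs_dot dia prec ->
     exists! l : I * I,
       l \in Lambda /\
       (alpha1 l.2, frep l.1 l.2) \in (C : {set cochains H I})).

End CyclicData.

Definition t1_of (b u s : nat) : nat :=
  if b == 0%N then u.+1 else minn u.+1 s.

(* v + d + p ^ s * v * d > 0 when b != 0, so logn p is the p-adic valuation. *)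
Definition t2_of (p b u v s d : nat) : nat :=
  if b == 0%N then u.+1
  else if s != u.+1 then t1_of b u s
  else (s + logn p (v + d + p ^ s * v * d))%N.

(* Main.v *)
Require Import Defs.
From HB Require Import structures.
From mathcomp Require Import all_boot all_order all_fingroup all_algebra.
From mathcomp Require Import ring.

(* Up to a coboundary the first component of a 2-cocycle is the carry cocycle
   [alpha1 g], where [g] is the sum of the values beta(x, 1).  Once
   beta = [alpha1 g], the second component is determined by f0 = f(1, 1):
   the condition on f(x, y + z) gives f(1, _), and the condition on f(x + y, z)
   with x = 1 then climbs along the powers of 1 for the operation [lcs_times].
   Summing the two conditions over the whole of H shows that a g = g and
   b g = 0.  Conversely, for such a g, writing the carries as the defect of
   additivity of representatives reduces the conditions to a crossed
   homomorphism equation on the cyclic group (H, lcs_times), acting through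
   omega = a (1 + b); it is solved by geometric sums, with a quadratic
   correction, for every f0.  Finally the coboundaries of the homomorphisms
   H -> I move f0 exactly by the multiples of 1 - omega.  So the pair (f0, g)
   classifies the cocycles, with f0 modulo 1 - omega and g killed by a - 1
   and b, and p ^ t2 and p ^ t1 are the p-adic forms of these two conditions. *)

Set Implicit Arguments.
Unset Strict Implicit.
Unset Printing Implicit Defensive.

Import GRing.Theory.
Local Open Scope ring_scope.

Lemma zmod_norm (V : finZmodType) (U : {set V}) x : x \in 'N(U)%g.
Proof.
exact: subsetP (sub_abelian_norm (FinRing.zmod_abelian [set: V]) (subsetT U)) _ (in_setT x).
Qed.

(** * Representatives and carries *)

Section ZpLift.
Variable N : nat.
Hypothesis N_gt1 : (1 < N)%N.

Definition lft (x : 'Z_N) : int := Posz x.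

Lemma lftK x : (lft x)%:~R = x.
Proof. exact: natr_Zp. Qed.

Lemma lft0 : lft 0 = 0.
Proof. by []. Qed.

Lemma Zp1_val : ((1%R : 'Z_N) : nat) = 1%N.
Proof. by rewrite /= Zp_cast // modn_small. Qed.

Lemma lft1 : lft 1 = 1.
Proof. by rewrite /lft Zp1_val. Qed.

Lemma lft_lt (x : 'Z_N) : (x < N)%N.
Proof. by apply: leq_trans (ltn_ord x) _; rewrite Zp_cast. Qed.

(** Divisibility by [N] is phrased as exactness of the quotient, the form that unfolds [carry] and
    [wrap], both built with [%/]. *)
Lemma intr_Zp_eq0 (n : int) : n%:~R = 0 :> 'Z_N -> (n %/ N)%Z * N = n.
Proof.
have nat0 (m : nat) : m%:R = 0 :> 'Z_N -> (N %| m)%N.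
  by move/(congr1 val); rewrite /dvdn -(val_Zp_nat N_gt1) => ->.
suff dvdNn : n%:~R = 0 :> 'Z_N -> (N%:Z %| n)%Z by move=> /dvdNn /divzK.
case: n => m; first by move/nat0.
by rewrite NegzE rmorphN /= => /eqP; rewrite oppr_eq0 dvdzE abszN -dvdzE => /eqP /nat0.
Qed.

Lemma ZpN0 : N%:R = 0 :> 'Z_N.
Proof. exact: pchar_Zp. Qed.

(** The 2-cocycle of the extension of Z by Z/N attached to least representatives. Identities between
    carries are proved in [int] after multiplication by [N]. *)
Definition carry (x y : 'Z_N) : int := ((lft x + lft y - lft (x + y)) %/ N)%Z.

Lemma carryE x y : carry x y * N = lft x + lft y - lft (x + y).
Proof. by apply: intr_Zp_eq0; rewrite !(rmorphB, rmorphD) /= !lftK subrr. Qed.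

Lemma N_neq0 : N%:Z != 0.
Proof. by case: N N_gt1. Qed.

Lemma carry_bool x y : carry x y = Posz (N <= (x : nat) + (y : nat))%N.
Proof.
apply: (mulIf N_neq0); rewrite carryE.
have -> : lft (x + y) = Posz ((x + y) %% N)%N 
  by rewrite /lft -{1}(natr_Zp x) -{1}(natr_Zp y) -natrD val_Zp_nat.
rewrite /lft -PoszD; case: leqP => [le_N|lt_N].
  have -> : ((x + y) %% N = x + y - N)%N.
    rewrite -{1}(subnK le_N) modnDr modn_small //.
    by rewrite ltn_subLR // -addSn leq_add ?lft_lt // ltnW ?lft_lt.
  by rewrite -subzn // mul1r opprB addrC subrK.
by rewrite modn_small // subrr mul0r.
Qed.

(** The ordinal bound hidden in ['Z_N] equals [N] only propositionally, by [1 < N]; this changes the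
    bound in a sum. *)
Lemma sum_Zp (V : nmodType) (F : nat -> V) :
  \sum_(x : 'Z_N) F x = \sum_(i < N) F i.
Proof. by rewrite -(big_mkord xpredT F) -(big_mkord xpredT F) Zp_cast. Qed.

(** Kept doubled to avoid a division; the factor 2 is cancelled later in [R]. *)
Lemma sum_lft : (\sum_x lft x) *+ 2 = N%:Z * (N%:Z - 1).
Proof.
rewrite /lft; transitivity (Posz ((\sum_(i < N) i) * 2)%N).
  rewrite muln2 -addnn PoszD mulr2n.
  by rewrite (sum_Zp Posz) (big_morph Posz PoszD (erefl _)).
have -> : (\sum_(i < N) i = 'C(N, 2))%N by rewrite -(big_mkord xpredT (fun i => i)) bin2_sum.
have odd0 : odd (N * N.-1) = false by rewrite oddM; case: N N_gt1 => // n _; rewrite /= andNb.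
rewrite bin2 muln2 halfK odd0 subn0 PoszM.
by case: N N_gt1 => // n _; rewrite intS [1 + _]addrC addrK.
Qed.

(** Translation by [y] permutes the group, so in the sum of [carryE] only [N] copies of [lft y]
    remain. *)
Lemma sum_carry y : \sum_x carry x y = lft y.
Proof.
apply: (mulIf N_neq0); rewrite mulr_suml.
under eq_bigr do rewrite carryE.
rewrite sumrB big_split /= addrAC -(reindex_inj (addIr y) (P := xpredT) (F := lft)).
by rewrite subrr add0r sumr_const card_ord Zp_cast // -mulr_natr natz.
Qed.

Lemma carryC x y : carry x y = carry y x.
Proof. by rewrite /carry (addrC x) (addrC (lft x)). Qed.

Lemma carry0 x : carry x 0 = 0.
Proof. by rewrite /carry (addr0 x) lft0 addr0 subrr div0z. Qed.

End ZpLift.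

(** * The linear cycle set on Z/p^eta *)

Section LinearCycleSet.
Variables p nu eta : nat.
Hypotheses (p_prime : prime p) (p_odd : odd p).
Hypotheses (nu_gt0 : (0 < nu)%N) (le_nu_eta : (nu <= eta)%N).
Hypothesis le_eta_2nu : (eta <= 2 * nu)%N.

Local Notation N := (p ^ eta)%N.
Local Notation P := (p ^ nu)%N.
Local Notation M := (p ^ (2 * nu - eta))%N.
Local Notation H := 'Z_(p ^ eta).
Local Notation dot := (@lcs_dot p nu eta).

Lemma order_gt1 : (1 < N)%N.
Proof. by rewrite -{1}(expn0 p) ltn_exp2l ?prime_gt1 // (leq_trans nu_gt0). Qed.
Let N_gt1 := order_gt1.

Lemma sqrP : (P * P = M * N)%N.
Proof. by rewrite -!expnD subnK // mul2n addnn. Qed.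

Lemma dvd_P_N : (P %| N)%N.
Proof. exact: dvdn_exp2l. Qed.

Lemma sqrP_Zp : (P%:R : H) * P%:R = 0.
Proof. by rewrite -natrM sqrP natrM ZpN0 // mulr0. Qed.

Lemma dotE x y : dot x y = (1 - P%:R * x) * y. Proof. by []. Qed.

Lemma dotDr x y z : dot x (y + z) = dot x y + dot x z.
Proof. exact: mulrDr. Qed.

Lemma dot0r x : dot x 0 = 0. Proof. exact: mulr0. Qed.

Lemma dot0l x : dot 0 x = x. Proof. by rewrite dotE mulr0 subr0 mul1r. Qed.

(** The linear cycle set identity: the two factors 1 - P x and 1 - P (1 - P x) y multiply to 1 - P
    (x + y) because [P] squares to zero in [H]. *)
Lemma dotA x y z : dot (dot x y) (dot x z) = dot (x + y) z.
Proof.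
rewrite !dotE; have := sqrP_Zp; set q : H := P%:R => q2.
rewrite mulrA; congr (_ * _).
transitivity (1 - q * (x + y) + (q * q) * (2 * x * y - q * x * x * y)); first by ring.
by rewrite q2 mul0r addr0.
Qed.

Lemma dot_bij x : bijective (dot x).
Proof.
have := sqrP_Zp; set q : H := P%:R => q2.
exists (fun y => (1 + q * x) * y) => y; rewrite dotE -/q mulrA.
  transitivity (y - (q * q) * x * x * y); first by ring.
  by rewrite q2 !mul0r subr0.
transitivity (y - (q * q) * x * x * y); first by ring.
by rewrite q2 !mul0r subr0.
Qed.

(* [dot x y] is represented by [(1 - P x) y - N * wrap x y]. *)
Definition wrap (x y : H) : int := (((1 - P%:Z * lft x) * lft y - lft (dot x y)) %/ N)%Z.

Lemma wrapE x y : wrap x y * N = (1 - P%:Z * lft x) * lft y - lft (dot x y).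
Proof.
apply: intr_Zp_eq0 => //; rewrite rmorphB /= lftK rmorphM rmorphB rmorphM /= !lftK.
by rewrite dotE -pmulrn subrr.
Qed.

Lemma lft_dot x y : lft (dot x y) = (1 - P%:Z * lft x) * lft y - wrap x y * N.
Proof. by rewrite wrapE subKr. Qed.

Lemma lftD (x y : H) : lft (x + y) = lft x + lft y - carry x y * N.
Proof. by rewrite carryE // subKr. Qed.

Lemma wrap0l y : wrap 0 y = 0.
Proof. by rewrite /wrap dot0l lft0 mulr0 subr0 mul1r subrr div0z. Qed.

Lemma wrap0r x : wrap x 0 = 0.
Proof. by rewrite /wrap dot0r lft0 mulr0 subr0 div0z. Qed.

(** [dot x] is additive, so after multiplication by [N] both sides are the same combination of
    representatives. *)
Lemma carry_dot x y z : carry y z - carry (dot x y) (dot x z) =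
  P%:Z * lft x * carry y z + wrap x y + wrap x z - wrap x (y + z).
Proof.
apply: (mulIf (N_neq0 N_gt1)).
have dist (a c e f g : int) : (g * a + c + e - f) * N%:Z =
  g * (a * N%:Z) + c * N%:Z + e * N%:Z - f * N%:Z by ring.
rewrite mulrBl dist !carryE // !wrapE -dotDr.
by ring.
Qed.

(** The integral refinement of [dotA]: the term in [P * P], zero in [H], equals [M * N] and leaves a
    multiple of [M] once [N] is divided out. *)
Lemma wrap_cocycle x y z :
  wrap x z * (1 - P%:Z * lft (dot x y)) + wrap (dot x y) (dot x z) - wrap (x + y) z =
  (M%:Z * lft x * (lft y + lft (dot x y)) - P%:Z * (carry x y - wrap x y)) * lft z.
Proof.
have N0 : N%:Z != 0 by exact: N_neq0.
have MN : M%:Z * N = P%:Z * P by rewrite -!PoszM sqrP.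
apply: (mulIf N0).
have -> : forall A B C : int, (A * (1 - P%:Z * B) + C - wrap (x + y) z) * N =
   A * N * (1 - P%:Z * B) + C * N - wrap (x + y) z * N by move=> A B C; ring.
rewrite !wrapE dotA.
have -> : (M%:Z * lft x * (lft y + lft (dot x y)) - P%:Z * (carry x y - wrap x y)) * lft z * N
  = ((M%:Z * N) * lft x * (lft y + lft (dot x y)) - P%:Z * (carry x y * N - wrap x y * N)) * lft z by ring.
rewrite MN carryE // wrapE.
rewrite (_ : lft (dot x z) = (1 - P%:Z * lft x) * lft z - wrap x z * N) ?lft_dot //.
rewrite wrapE.
move: (lft x) (lft y) (lft z) (lft (dot x y)) (lft (x + y)) (lft (dot (x + y) z)) (lft (dot x z)) P%:Z => *.
ring.
Qed.

Lemma one_powE m : @one_pow p nu eta m = (m + 'C(m, 2) * P)%:R.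
Proof.
have := sqrP_Zp; elim: m => [|m IHm] q2; first by rewrite mul0n.
rewrite -[LHS]/(lcs_times nu (@one_pow p nu eta m) 1) IHm // /lcs_times binS bin1 -[m.+1]addn1 !(natrD, natrM).
set q : H := P%:R in q2 *; set t : H := 'C(m, 2)%:R.
transitivity (m%:R + 1 + (t + m%:R) * q + (q * q) * t : H); first by ring.
by rewrite q2 mul0r addr0.
Qed.

(** With [addr1_b_idx], this shows why [b_idx m] appears: taking x = 1 and y = [b_idx m] in the
    condition on f(x + y, z) passes from the power [m] of 1 to the next one. *)
Lemma dot1_b_idx m : dot 1 (@b_idx p nu eta m) = @one_pow p nu eta m.
Proof.
have := sqrP_Zp; rewrite one_powE /b_idx dotE binS bin1 !natrD !natrM natrD.
set q : H := P%:R; set t : H := 'C(m, 2)%:R => q2.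
transitivity (m%:R + t * q - (q * q) * (t + m%:R) : H); first by ring.
by rewrite q2 mul0r subr0.
Qed.

Lemma addr1_b_idx m : 1 + @b_idx p nu eta m = @one_pow p nu eta m.+1.
Proof. by rewrite one_powE /b_idx -[1]/(1%:R) -natrD addnA add1n. Qed.

Lemma unit2_Zp : (2%:R : H) \is a GRing.unit.
Proof. by rewrite unitZpE // coprimeXl // coprimen2. Qed.

Lemma natr_bin2 (S : pzRingType) n : 2%:R * 'C(n, 2)%:R = n%:R * (n%:R - 1) :> S.
Proof.
rewrite -natrM mul2n bin2; case: n => [|n]; first by rewrite mul0r.
have odd0 : odd (n.+1 * n) = false by rewrite oddM /= andNb.
by rewrite halfK odd0 subn0 natrM -natr1 addrK.
Qed.

(* Modulo [P ^+ 2 = 0], the equation [m + P m(m-1)/2 = x] is solved by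
   [m = x - P x(x-1)/2]. *)
Lemma one_pow_surj x : exists m : 'I_N, @one_pow p nu eta m = x.
Proof.
pose h2 := (2%:R : H)^-1.
have h2K : 2%:R * h2 = 1 by rewrite divrr // unit2_Zp.
have q2 := sqrP_Zp; set q : H := P%:R in q2.
have [y yE] : exists y : H, y = x - q * h2 * x * (x - 1) by exists (x - q * h2 * x * (x - 1)).
exists (Ordinal (lft_lt N_gt1 y)).
rewrite one_powE [nat_of_ord _]/(nat_of_ord y) natrD natrM natr_Zp -/q.
have bin2y := natr_bin2 H y; rewrite natr_Zp in bin2y.
have -> : 'C(y, 2)%:R = h2 * (y * (y - 1)) by rewrite -bin2y mulrA [h2 * _]mulrC h2K mul1r.
rewrite yE; set z := h2 * x * (x - 1).
transitivity (x + (q * q) * (- h2 * z * (x - 1) - h2 * (x - q * z) * z)); first by rewrite /z; ring.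
by rewrite q2 mul0r addr0.
Qed.

(** Representatives are reduced modulo [N], but [P] divides [N], so classes modulo [P] make sense on
    [H]. *)
Lemma modP_add_mul (y t : H) : ((y + P%:R * t)%R : H) = y %[mod P].
Proof.
rewrite -[X in (X + _)%R](natr_Zp y) -[X in (_ * X)%R](natr_Zp t) -natrM -natrD val_Zp_nat //.
by rewrite modn_dvdm ?dvd_P_N // mulnC addnC modnMDl.
Qed.

Lemma dot_modP x y : dot x y = y %[mod P].
Proof.
by rewrite -(modP_add_mul y (- (x * y))) dotE; congr ((_ : H) %% _)%N; ring.
Qed.

(** * Cocycles with values in a ring *)

Section Cocycles.
Variables (R : finComNzRingType) (a b : nat).
Local Notation al := (a%:R : R).
Local Notation be := (b%:R : R).
Local Notation om := (a%:R * (1 + b%:R) : R).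
(** The arithmetic of the coefficients enters only through these hypotheses. [om_sum] yields both
    the period [P] of [om] and the vanishing of its geometric sum over a period. *)
Hypothesis P0 : P%:R = 0 :> R.
Hypothesis be2 : be * be = 0.
Hypothesis om_sum : \sum_(i < P) om ^+ i = 0.
Hypothesis two_inj : forall x : R, x *+ 2 = 0 -> x = 0.

Let A : {additive R -> R} := homothety a.
Let B : {additive R -> R} := homothety b.
Let dia (h : H) : {additive R -> R} := homothety (a ^ h).
Let prec (h : H) : {additive R -> R} := homothety (h * b).

(** * Reduction from [H] to [R], powers and geometric sums *)

Definition red (x : H) : R := (lft x)%:~R.
Definition ppow (x : H) : R := al ^+ x.
Definition geo (n : nat) : R := \sum_(i < n) om ^+ i.

Lemma natr_N0 : N%:R = 0 :> R.
Proof. by rewrite -(subnK le_nu_eta) expnD natrM P0 mulr0. Qed.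

Lemma lft_natr (x : H) : (lft x)%:~R = x%:R :> R. Proof. by []. Qed.

Lemma redD x y : red (x + y) = red x + red y.
Proof.
by rewrite /red lftD rmorphB rmorphD rmorphM /= -(pmulrn _ N) natr_N0 mulr0 subr0.
Qed.

Lemma red_dot x y : red (dot x y) = red y.
Proof.
rewrite /red lft_dot rmorphB rmorphM rmorphB rmorphM /= -!pmulrn.
by rewrite rmorphM /= -[N%:~R]pmulrn P0 natr_N0 mul0r mulr0 !subr0 mul1r.
Qed.

Lemma red0 : red 0 = 0. Proof. by []. Qed.

Lemma red1 : red 1 = 1. Proof. by rewrite /red lft1. Qed.

Lemma om_P : om ^+ P = 1.
Proof. by apply/eqP; rewrite -subr_eq0 subrX1 om_sum mulr0. Qed.

(** The binomial expansion of (1 + b)^n stops at the linear term, since b squares to zero. *)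
Lemma omX n : om ^+ n = al ^+ n * (1 + n%:R * be).
Proof.
elim: n => [|n IHn]; first by rewrite !expr0 mul0r addr0 mulr1.
rewrite exprS IHn exprS -natr1.
transitivity (al * al ^+ n * (1 + (n%:R + 1) * be + n%:R * (be * be))); first by ring.
by rewrite be2 mulr0 addr0.
Qed.

Lemma al_P : al ^+ P = 1.
Proof. by have := om_P; rewrite omX P0 mul0r addr0 mulr1. Qed.

Lemma exp_modP (z : R) m n : z ^+ P = 1 -> m = n %[mod P] -> z ^+ m = z ^+ n.
Proof. by move=> zP mn; rewrite -(expr_mod m zP) mn expr_mod. Qed.

Lemma ppow_nat n : ppow n%:R = al ^+ n.
Proof.
by apply: exp_modP al_P _; rewrite val_Zp_nat // modn_dvdm // dvd_P_N.
Qed.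

Lemma ppow_dot x y : ppow (dot x y) = ppow y.
Proof. exact: exp_modP al_P (dot_modP x y). Qed.

Lemma ppowD x y : ppow (x + y) = ppow x * ppow y.
Proof. by have := ppow_nat (x + y)%N; rewrite natrD !natr_Zp exprD. Qed.

Lemma om_ppow (x : H) : om ^+ x = ppow x * (1 + red x * be).
Proof. exact: omX. Qed.

Lemma geoD m n : geo (m + n) = geo m + om ^+ m * geo n.
Proof.
rewrite /geo big_split_ord mulr_sumr; congr (_ + _).
by apply: eq_bigr => i _; rewrite exprD.
Qed.

Lemma geo_PM n : geo (n * P) = 0.
Proof.
elim: n => [|n IHn]; first by rewrite mul0n /geo big_ord0.
by rewrite mulSn geoD IHn mulr0 addr0; apply: om_sum.
Qed.

Lemma geo_mod n : geo (n %% P) = geo n.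
Proof.
by rewrite {2}(divn_eq n P) geoD geo_PM add0r mulnC exprM om_P expr1n mul1r.
Qed.

Lemma geo_modP m n : m = n %[mod P] -> geo m = geo n.
Proof. by move=> mn; rewrite -geo_mod mn geo_mod. Qed.

Lemma geo_dot x y : geo (dot x y) = geo y.
Proof. exact: geo_modP (dot_modP x y). Qed.

(** The crossed homomorphism rule for the action through [om]. It descends to [H] because [geo]
    depends on its argument modulo [P] only. *)
Lemma geo_add (x y : H) : geo (x + y : H)%R = geo y + om ^+ y * geo x.
Proof.
rewrite -geoD; apply: geo_modP.
rewrite -[X in (X + _)%R](natr_Zp x) -[X in (_ + X)%R](natr_Zp y) -natrD.
by rewrite val_Zp_nat // modn_dvdm ?dvd_P_N // addnC.
Qed.

Lemma geo_H : \sum_(x : H) om ^+ x = 0.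
Proof.
rewrite (sum_Zp N_gt1 (fun i => om ^+ i)) -/(geo N).
by rewrite -(subnK le_nu_eta) expnD geo_PM.
Qed.

(** * The cocycle conditions in [R] and the cocycles [canon] *)

Lemma alphaE g x y : @alpha1 p eta R g (x, y) = g * (carry x y)%:~R.
Proof. by rewrite ffunE carry_bool //=; case: leqP; rewrite ?mulr0 ?mulr1. Qed.

Lemma AE y : A y = al * y. Proof. by rewrite mulr_natl. Qed.

Lemma BE y : B y = be * y. Proof. by rewrite mulr_natl. Qed.

Lemma diaE x y : dia x y = ppow x * y.
Proof. by rewrite /ppow -natrX mulr_natl. Qed.

Lemma precE x y : prec x y = red x * be * y.
Proof. by rewrite /red lft_natr -natrM mulr_natl. Qed.

(** The actions are multiplied out. As [ppow] and [red] are blind to [dot x], the acting elements x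
    · y and (x + y) · z lose their first factor. *)
Record cocycle_eqs (c : cochains H R) : Prop := CocycleEqs {
  cocy_c1_0 : forall x, c.1 (x, 0) = 0;
  cocy_c1_0l : forall x, c.1 (0, x) = 0;
  cocy_c2_0 : forall x, c.2 (x, 0) = 0;
  cocy_c2_0l : forall x, c.2 (0, x) = 0;
  cocy_c1C : forall x y, c.1 (x, y) = c.1 (y, x);
  cocy_c1A : forall x y z, c.1 (y, z) - c.1 (x + y, z) + c.1 (x, y + z) - c.1 (x, y) = 0;
  cocy_c2D : forall x y z, c.2 (x, y + z) =
    c.2 (x, y) + c.2 (x, z) + ppow x * c.1 (y, z) - c.1 (dot x y, dot x z);
  cocy_c2Dl : forall x y z, c.2 (x + y, z) =
    ppow y * c.2 (x, z) + c.2 (dot x y, dot x z) + red z * be * ppow y * c.2 (x, y)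
    + red z * be * ppow (x + y) * c.1 (x, y) }.

Lemma cocycleP c : reflect (cocycle_eqs c) (is_2cocycle dot dia prec c).
Proof.
have c2D x y z : (c.2 (x, y + z) - c.2 (x, y) - c.2 (x, z) =
    dia x (c.1 (y, z)) - c.1 (dot x y, dot x z)) <-> (c.2 (x, y + z) =
    c.2 (x, y) + c.2 (x, z) + ppow x * c.1 (y, z) - c.1 (dot x y, dot x z)).
  by rewrite diaE; split=> E; [rewrite -addrA -E|rewrite E]; ring.
have c2Dl x y z : dia (dot x y) (c.2 (x, z)) + c.2 (dot x y, dot x z)
         + prec (dot (x + y) z) (dia (dot x y) (c.2 (x, y)))
         + prec (dot (x + y) z) (dia (x + y) (c.1 (x, y))) =
    ppow y * c.2 (x, z) + c.2 (dot x y, dot x z) + red z * be * ppow y * c.2 (x, y)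
    + red z * be * ppow (x + y) * c.1 (x, y).
  by rewrite !precE !diaE ppow_dot red_dot !mulrA.
apply: (iffP and5P) => [[h1 h2 h3 h4 h5]|[c10 c10l c20 c20l cC cA cD cDl]].
  split.
  - by move=> x; have /and4P[/eqP] := forallP h1 x.
  - by move=> x; have /and4P[_ /eqP] := forallP h1 x.
  - by move=> x; have /and4P[_ _ /eqP] := forallP h1 x.
  - by move=> x; have /and4P[_ _ _ /eqP] := forallP h1 x.
  - by move=> x y; apply/eqP: (forallP (forallP h2 x) y).
  - by move=> x y z; apply/eqP: (forallP (forallP (forallP h3 x) y) z).
  - by move=> x y z; apply/c2D; apply/eqP: (forallP (forallP (forallP h4 x) y) z).
  - by move=> x y z; rewrite -c2Dl; apply/eqP: (forallP (forallP (forallP h5 x) y) z).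
split; do ?[apply/forallP=> ?].
- by rewrite c10 c10l c20 c20l !eqxx.
- by apply/eqP.
- by rewrite cA.
- by apply/eqP/c2D.
- by apply/eqP; rewrite c2Dl.
Qed.

(** In [R] the multiple of [P] in [carry_dot] disappears, and [dot x] changes the carries by the
    coboundary of [wrap x]. *)
Lemma carry_dot_red x y z : (carry (dot x y) (dot x z))%:~R =
  (carry y z)%:~R - (wrap x y)%:~R - (wrap x z)%:~R + (wrap x (y + z))%:~R :> R.
Proof.
have /(congr1 (fun n : int => n%:~R : R)) := carry_dot x y z.
rewrite !(rmorphB, rmorphD, rmorphM) /= -[P%:~R]pmulrn P0 !mul0r add0r => E.
transitivity ((carry y z)%:~R -
  ((carry y z)%:~R - (carry (dot x y) (dot x z))%:~R) : R); first by ring.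
by rewrite E; ring.
Qed.

(** Only the [M] term of [wrap_cocycle] survives in [R]; its factor 2 arises because [y] and
    [dot x y] have the same reduction. *)
Lemma wrap_add_red x y z : (wrap (x + y) z)%:~R =
  (wrap x z)%:~R + (wrap (dot x y) (dot x z))%:~R - 2%:R * M%:R * red x * red y * red z :> R.
Proof.
have /(congr1 (fun n : int => n%:~R : R)) := wrap_cocycle x y z.
rewrite !(rmorphB, rmorphD, rmorphM, rmorph1) /= -[P%:~R]pmulrn P0 !mul0r !subr0 mulr1.
rewrite -!/(red _) red_dot -[M%:~R]pmulrn => E.
transitivity ((wrap x z)%:~R + (wrap (dot x y) (dot x z))%:~R -
  ((wrap x z)%:~R + (wrap (dot x y) (dot x z))%:~R - (wrap (x + y) z)%:~R) : R); first by ring.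
by rewrite E; ring.
Qed.

Lemma carry_cocycle (x y z : H) :
  carry y z - carry (x + y) z + carry x (y + z) - carry x y = 0.
Proof.
apply: (mulIf (N_neq0 N_gt1)); rewrite !(mulrBl, mulrDl) !carryE // (addrA x) mul0r.
by ring.
Qed.

(* The term in [phi] solves the crossed homomorphism equation for [om]; the
   quadratic term absorbs the right-hand side of [wrap_cocycle]. *)
Definition canon (phi g : R) : cochains H R := (@alpha1 p eta R g,
  [ffun xy : H * H => red xy.2 * geo xy.1 * phi - M%:R * g * red xy.1 ^+ 2 * red xy.2
     - g * (wrap xy.1 xy.2)%:~R]).

Lemma canonE phi g x y : (canon phi g).2 (x, y) =
  red y * geo x * phi - M%:R * g * red x ^+ 2 * red y - g * (wrap x y)%:~R.
Proof. exact: ffunE. Qed.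

Lemma ppow_fix g x : al * g = g -> ppow x * g = g.
Proof.
by move=> ag; rewrite /ppow; elim: (x : nat) => [|n IHn];
  rewrite ?mul1r // exprSr -mulrA ag.
Qed.

Lemma canon_cocycle phi g :
  al * g = g -> be * g = 0 -> is_2cocycle dot dia prec (canon phi g).
Proof.
move=> ag bg; apply/cocycleP; split => [x|x|x|x|x y|x y z|x y z|x y z];
  rewrite ?canonE ?alphaE.
- by rewrite carry0 mulr0.
- by rewrite carryC carry0 mulr0.
- by rewrite red0 wrap0r !mul0r !mulr0 !subr0.
- by rewrite wrap0l red0 /geo big_ord0; ring.
- by rewrite carryC.
- have -> : g * (carry y z)%:~R - g * (carry (x + y) z)%:~R +
    g * (carry x (y + z))%:~R - g * (carry x y)%:~R =
    g * (carry y z - carry (x + y) z + carry x (y + z) - carry x y)%:~R.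
    by rewrite !(rmorphB, rmorphD) /=; ring.
  by rewrite carry_cocycle mulr0.
- rewrite redD carry_dot_red mulrA ppow_fix //.
  by ring.
- rewrite redD geo_add geo_dot red_dot wrap_add_red om_ppow !red_dot.
  set E := ppow y; set wxy := (wrap x y)%:~R; set c := (carry x y)%:~R.
  have Eg : E * g = g by exact: ppow_fix.
  have Fg : ppow (x + y) * g = g by exact: ppow_fix.
  (* Terms are grouped so that [g] occurs under an action only as [E * g] or [be * g], which the
     hypotheses simplify. The cross term of [red (x + y) ^+ 2] cancels that of [wrap_add_red]. *)
  transitivity (red z * (geo y + E * (1 + red y * be) * geo x) * phi
     - M%:R * (E * g) * red x ^+ 2 * red z - M%:R * g * red y ^+ 2 * red z
     - (E * g) * (wrap x z)%:~R - g * (wrap (dot x y) (dot x z))%:~R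
     - (be * g) * E * red z * (M%:R * red x ^+ 2 * red y + wxy)
     + (be * g) * red z * ppow (x + y) * c); last by ring.
  by rewrite bg Eg; ring.
Qed.

(** * Constraints on the coefficient of the carry cocycle *)

Lemma additive_red (g : H -> R) :
  (forall y z, g (y + z) = g y + g z) -> forall x, g x = red x * g 1.
Proof.
move=> gD x; rewrite /red lft_natr -[in LHS](natr_Zp x).
have g0 : g 0 = 0 by apply: (addrI (g 0)); rewrite -gD !addr0.
elim: (x : nat) => [|n IHn]; first by rewrite mul0r g0.
by rewrite -natr1 gD IHn -natr1 mulrDl mul1r.
Qed.

Lemma sum_const (z : R) : \sum_(y : H) z = 0.
Proof. by rewrite sumr_const card_ord Zp_cast // -mulr_natr natr_N0 mulr0. Qed.

(** Sum the equation for f(1, y + 1) over y. The shift preserves the sum of f, the constant f(1, 1)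
    contributes [N] times itself, hence 0, and the carries leave a g - g, because [dot 1] permutes
    [H]. *)
Lemma cocycle_al c g : cocycle_eqs c -> (forall x y, c.1 (x, y) = g * (carry x y)%:~R) ->
  al * g = g.
Proof.
case=> _ _ _ _ _ _ cD _ c1.
have sumc (x : H) : \sum_y g * (carry y x)%:~R = g * red x.
  by rewrite -mulr_sumr /red -(sum_carry N_gt1 x) rmorph_sum.
have : \sum_y c.2 (1, y + 1) = \sum_y c.2 (1, y) + \sum_(y : H) c.2 (1, 1)
   + \sum_y ppow 1 * c.1 (y, 1) - \sum_y c.1 (dot 1 y, dot 1 1).
  by rewrite -!big_split -sumrB /=; apply: eq_bigr => y _; rewrite cD.
have sH (F : H -> R) : \sum_y F (y + 1) = \sum_y F y.
  by rewrite [RHS](reindex_inj (addIr 1)).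
have sD (F : H -> R) : \sum_y F (dot 1 y) = \sum_y F y.
  by rewrite [RHS](reindex_inj (bij_inj (dot_bij 1))).
rewrite (sH (fun y => c.2 (1, y))) (sD (fun y => c.1 (y, dot 1 1))) -mulr_sumr.
under [X in _ * X]eq_bigr do rewrite c1.
under [X in _ - X]eq_bigr do rewrite c1.
rewrite !sumc red_dot red1 mulr1 sum_const addr0.
have -> : ppow 1 = al by rewrite -[1]/(1%:R) ppow_nat expr1.
rewrite -addrA => E; apply/subr0_eq/(addrI (\sum_y c.2 (1, y))).
by rewrite -E addr0.
Qed.

Lemma sum_red : (\sum_x red x) *+ 2 = 0.
Proof.
rewrite -(rmorph_sum (intmul 1)) -rmorphMn /= sum_lft // rmorphM /= -(pmulrn _ N).
by rewrite natr_N0 mul0r.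
Qed.

Lemma sum_wrap1 : (\sum_y (wrap 1 y)%:~R) *+ 2 = 0 :> R.
Proof.
suff E : (\sum_y wrap 1 y) *+ 2 = - P%:Z * (N%:Z - 1).
  rewrite -(rmorph_sum (intmul 1)) -rmorphMn /= E rmorphM rmorphN /= -(pmulrn _ P).
  by rewrite P0 oppr0 mul0r.
apply: (mulIf (N_neq0 N_gt1)); rewrite mulrnAl mulr_suml.
under eq_bigr do rewrite wrapE lft1 // mulr1.
rewrite sumrB -mulr_sumr.
rewrite -[X in _ - X](reindex_inj (bij_inj (dot_bij 1)) (P := xpredT) (F := @lft N)).
transitivity (- P%:Z * ((\sum_(x : H) lft x) *+ 2)); first by rewrite /=; ring.
by rewrite sum_lft //; ring.
Qed.

(* Summing the equation for f(1 + y, 1) over y kills every term but b g, up to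
   sums that are only seen to vanish after doubling. *)
Lemma cocycle_be c g : cocycle_eqs c -> (forall x y, c.1 (x, y) = g * (carry x y)%:~R) ->
  be * g = 0.
Proof.
move=> cc c1; have ag := cocycle_al cc c1; case: cc => _ _ _ _ _ _ cD cDl.
(* Corrected by the quadratic and [wrap] terms of [canon], f(x, _) becomes additive, so f is
   determined by the values [G x] at 1. *)
pose G x := c.2 (x, 1) + M%:R * g * red x ^+ 2 + g * (wrap x 1)%:~R.
have c2E x y : c.2 (x, y) = red y * G x - M%:R * g * red x ^+ 2 * red y - g * (wrap x y)%:~R.
  pose F y := c.2 (x, y) + M%:R * g * red x ^+ 2 * red y + g * (wrap x y)%:~R.
  have FD z t : F (z + t) = F z + F t.
    by rewrite /F cD !c1 redD carry_dot_red mulrA ppow_fix //; ring.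
  by have := additive_red FD y; rewrite /F red1 mulr1 -/(G x) => <-; ring.
(* A crossed equation for [om] up to multiples of b g. Summed over y, the two sums of [G] agree and
   the powers of [om] vanish. *)
have GE y : G (1 + y) = om ^+ y * G 1 + G (dot 1 y) +
    be * g * ((carry 1 y)%:~R - (wrap 1 y)%:~R - M%:R * red y).
  have := cDl 1 y 1; rewrite !c2E c1 wrap_add_red redD red_dot red_dot red1 om_ppow.
  have Eg : ppow y * g = g by exact: ppow_fix.
  have Fg : ppow (1 + y) * g = g by exact: ppow_fix.
  set E := ppow y in Eg *; set F := ppow _ in Fg *.
  set wy := (wrap 1 y)%:~R; set wd := (wrap (dot 1 y) _)%:~R; set w1 := (wrap 1 1)%:~R.
  move=> eqG.
  transitivity ((1 * G (1 + y) - M%:R * g * (1 + red y) ^+ 2 * 1 -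
     g * (w1 + wd - 2%:R * M%:R * 1 * red y * 1)) + M%:R * g * (1 + red y) ^+ 2
      + g * (w1 + wd - 2%:R * M%:R * red y)); first by ring.
  rewrite eqG.
  transitivity (E * (1 + red y * be) * G 1 + G (dot 1 y) +
     be * (F * g * (carry 1 y)%:~R - E * g * wy - M%:R * red y * (E * g))
    + M%:R * (g - E * g) + w1 * (g - E * g)); first by ring.
  by rewrite Eg Fg; ring.
have sH (F : H -> R) : \sum_y F (1 + y) = \sum_y F y.
  by rewrite [RHS](reindex_inj (addrI 1)).
have sD (F : H -> R) : \sum_y F (dot 1 y) = \sum_y F y.
  by rewrite [RHS](reindex_inj (bij_inj (dot_bij 1))).
clearbody G; have := sH G; under eq_bigr do rewrite GE.
rewrite !big_split /= -mulr_suml geo_H mul0r add0r (sD G) -mulr_sumr => E.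
have {}E : be * g * \sum_(y : H) ((carry 1 y)%:~R - (wrap 1 y)%:~R - M%:R * red y) = 0.
  by apply: (addrI (\sum_y G y)); rewrite E addr0.
(* Doubling kills the sums of [wrap] and [red], while the carries sum to 1. *)
apply: two_inj; rewrite -[RHS](mul0rn _ 2) -E !sumrB -mulr_sumr.
have -> : \sum_(y : H) (carry 1 y)%:~R = 1 :> R.
  transitivity (red 1); last exact: red1.
  rewrite /red -(sum_carry N_gt1) rmorph_sum.
  by apply: eq_bigr => y _; rewrite carryC.
set W := \sum_y (wrap 1 y)%:~R; set S := \sum_y red y.
transitivity (be * g *+ 2 - be * g * (W *+ 2) - be * g * M%:R * (S *+ 2)); last by ring.
by rewrite sum_wrap1 sum_red !mulr0 !subr0.
Qed.

(** * Coboundaries *)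

Definition cob (t : {ffun H -> R}) : cochains H R :=
  ([ffun xy : H * H => t xy.1 - t (xy.1 + xy.2) + t xy.2],
   [ffun xy : H * H => t (dot xy.1 xy.2) - ppow xy.1 * t xy.2
      - red xy.2 * be * (ppow xy.1 * t xy.1)]).

Lemma cob1 t x y : (cob t).1 (x, y) = t x - t (x + y) + t y.
Proof. exact: ffunE. Qed.

Lemma cob2 t x y : (cob t).2 (x, y) =
  t (dot x y) - ppow x * t y - red y * be * (ppow x * t x).
Proof. exact: ffunE. Qed.

Lemma coboundaryP c : reflect (exists2 t : {ffun H -> R}, t 0 = 0 & c = cob t)
  (is_coboundary dot dia prec c).
Proof.
apply: (iffP existsP) => [[t /andP[/eqP t0 /forallP ct]]|[t t0 ->]]; exists t.
  by [].
  rewrite [c]surjective_pairing; congr (_, _); apply/ffunP=> -[x y]; rewrite ffunE /=;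
    have /andP[/eqP c1 /eqP c2] := forallP (ct x) y; first by [].
  by rewrite c2 precE !diaE red_dot.
rewrite t0 eqxx; apply/forallP=> x; apply/forallP=> y.
by rewrite cob1 cob2 precE !diaE red_dot !eqxx.
Qed.

(** In the condition on f(x + y, z) the two sides differ by a multiple of b squared, which is 0. *)
Lemma cob_cocycle (t : {ffun H -> R}) : t 0 = 0 -> is_2cocycle dot dia prec (cob t).
Proof.
move=> t0; apply/cocycleP; split => [x|x|x|x|x y|x y z|x y z|x y z]; rewrite ?cob1 ?cob2.
- by rewrite addr0 t0 addr0 subrr.
- by rewrite add0r t0 sub0r addNr.
- by rewrite dot0r t0 red0 mulr0 !mul0r !subr0.
- by rewrite dot0l t0 /ppow expr0 mul1r subrr sub0r !mulr0 oppr0.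
- by rewrite (addrC y x); ring.
- by rewrite (addrA x y z); ring.
- by rewrite dotDr redD; ring.
- rewrite dotA ppow_dot !red_dot ppowD.
  transitivity (t (dot (x + y) z) - ppow x * ppow y * t z
    - red z * be * ppow x * ppow y * t (x + y) -
      (be * be) * red z * ppow y * red y * ppow x * t x); last by ring.
  by rewrite be2; ring.
Qed.

Lemma iterA n y : iter n A y = al ^+ n * y.
Proof. by elim: n => [|n IHn]; rewrite ?mul1r //= IHn AE mulrA -exprS. Qed.

(** * Cocycles whose first component is a carry cocycle *)

Section Normalized.
Variables (c : cochains H R) (g : R).
Hypothesis cc : cocycle_eqs c.
Hypothesis c1 : c.1 = @alpha1 p eta R g.
Local Notation f0 := (c.2 (1, 1)).
Local Notation ft := (@ftilde p nu eta R A f0 g).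

Let c1E x y : c.1 (x, y) = g * (carry x y)%:~R.
Proof. by rewrite c1 alphaE. Qed.

Lemma ppow1 : ppow 1 = al.
Proof. by rewrite -[1]/(1%:R) ppow_nat expr1. Qed.

(** Adding 1 to the second argument of f(1, _) adds f(1, 1) and one value of [Gam], so [fhat] is the
    resulting sum. *)
Lemma normalized_at1 x : c.2 (1, x) = ft x.
Proof.
rewrite -[x in LHS]natr_Zp /ftilde /fhat; case: cc => _ _ c20 _ _ _ cD _.
elim: (x : nat) => [|n IHn]; first by rewrite big_ord0 c20 addr0.
rewrite -natr1 cD IHn ppow1 mulrS big_ord_recr /= /Gam AE c1.
by ring.
Qed.

Lemma normalized_one_pow m x :
  c.2 (@one_pow p nu eta m, x) = @frep_pow p nu eta R A B f0 g m x.
Proof.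
have bg := cocycle_be cc c1E; case: cc => _ _ _ c20l _ _ _ cDl.
have bidx n : ppow (@b_idx p nu eta n) = al ^+ n.
  rewrite ppow_nat; apply: exp_modP al_P _.
  by rewrite addnC modnMDl.
elim: m x => [|m IHm] x; first by rewrite c20l /frep_pow !big_ord0 raddf0 mul0rn addr0.
(* The next power of 1 is split as 1 + y with y = [b_idx m], so that 1 · y is the power [m], to
   which the induction hypothesis applies. *)
rewrite -(addr1_b_idx m).
rewrite (cDl 1 (@b_idx p nu eta m) x).
rewrite (dot1_b_idx m).
rewrite IHm.
rewrite (c1E 1 (@b_idx p nu eta m)).
rewrite (bidx m).
rewrite (normalized_at1 x) (normalized_at1 (@b_idx p nu eta m)).
rewrite /frep_pow.
have mulrn_red (h : H) z : z *+ h = red h * z by rewrite /red lft_natr mulr_natl.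
rewrite big_ord_recl [\sum_(l < m.+1) _]big_ord_recr !mulrn_red !red_dot !BE !iterA subn0 subSS subn0 /=.
rewrite dot0l.
(* The induction hypothesis is used at 1 · x: acting by 1 and then by i is acting by i + 1, as [P]
   squares to zero. *)
have -> : \sum_(i < m) iter (m - bump 0 i) A (ft (dot (bump 0 i)%:R x)) =
          \sum_(j < m) iter (m - 1 - j) A (ft (dot j%:R (dot 1 x))).
  apply: eq_bigr => i _; congr (iter _ A (ft _)).
    by rewrite /bump leq0n add1n subn1 subnS predn_sub.
  rewrite /bump leq0n add1n -natr1 !dotE; set q : H := P%:R.
  transitivity ((1 - q * (i%:R + 1)) * x + (q * q) * (i%:R * x)); last by ring.
  by rewrite sqrP_Zp mul0r addr0.
rewrite /A; set S := \sum_(j < m) _; set T := \sum_(j < m) _; set z := (carry _ _)%:~R.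
set ft1 := ft x; set fb := ft _; set pp := ppow _.
(* The term produced by beta(1, y) has no counterpart in [frep_pow]; it is a multiple of b g, which
   is 0. *)
transitivity (al ^+ m * ft1 + S + red x * (be * (T + al ^+ m * fb)) + red x * pp * z * (be * g)).
  by ring.
by rewrite bg mulr0 addr0.
Qed.

Lemma normalized_eq : c = (@alpha1 p eta R g, @frep p nu eta R A B f0 g).
Proof.
rewrite [LHS]surjective_pairing c1; congr (_, _); apply/ffunP=> -[x y]; rewrite ffunE /=.
case: pickP => [m /eqP <-|none]; first exact: normalized_one_pow.
(* The default value of [frep] is never reached, every element being a power of 1. *)
by have [m mx] := one_pow_surj x; have := none m; rewrite mx eqxx.
Qed.

End Normalized.

(** * Two additive invariants of a cocycle *)

Definition rep (f0 g : R) : cochains H R :=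
  (@alpha1 p eta R g, @frep p nu eta R A B f0 g).
(** f(1, 1), corrected so that coboundaries act simply: on the coboundary of t the sum telescopes to
    t(1) - t(1 · 1), which cancels the value t(1 · 1) in f(1, 1) and leaves (1 - [om]) t(1). *)
Definition inv1 (c : cochains H R) : R :=
  c.2 (1, 1) + \sum_(i < dot 1 1) c.1 (i%:R, 1).
Definition inv2 (c : cochains H R) : R := \sum_x c.1 (x, 1).

Lemma cochD1 (c d : cochains H R) xy : (c + d).1 xy = c.1 xy + d.1 xy.
Proof. exact: ffunE. Qed.

Lemma cochD2 (c d : cochains H R) xy : (c + d).2 xy = c.2 xy + d.2 xy.
Proof. exact: ffunE. Qed.

Lemma cochN1 (c : cochains H R) xy : (- c).1 xy = - c.1 xy.
Proof. exact: ffunE. Qed.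

Lemma inv1D c d : inv1 (c + d) = inv1 c + inv1 d.
Proof.
rewrite /inv1 cochD2 addrACA -big_split; congr (_ + _).
by apply: eq_bigr => i _; rewrite cochD1.
Qed.

Lemma inv2D c d : inv2 (c + d) = inv2 c + inv2 d.
Proof. by rewrite -big_split; apply: eq_bigr => i _; rewrite cochD1. Qed.

Lemma cocycleD c d : is_2cocycle dot dia prec c -> is_2cocycle dot dia prec d ->
  is_2cocycle dot dia prec (c + d).
Proof.
move=> cc dd; have := @groupM _ [group of cocycles dot dia prec] c d.
by rewrite !inE; apply.
Qed.

Lemma cocycleN c : is_2cocycle dot dia prec c -> is_2cocycle dot dia prec (- c).
Proof.
move=> cc; have := @groupVr _ [group of cocycles dot dia prec] c.
by rewrite !inE; apply.
Qed.

Lemma carry1_small (i : nat) : (i.+1 < N)%N -> carry (i%:R : H) 1 = 0.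
Proof.
move=> iN; rewrite carry_bool // val_Zp_nat // modn_small ?(ltnW iN) //.
by rewrite (Zp1_val N_gt1) addn1 leqNgt iN.
Qed.

Lemma inv1_alpha1 c g : c.1 = @alpha1 p eta R g -> inv1 c = c.2 (1, 1).
Proof.
move=> c1; rewrite /inv1 big1 ?addr0 // => i _; rewrite c1 alphaE carry1_small ?mulr0 //.
by apply: leq_ltn_trans (ltn_ord i) (lft_lt N_gt1 _).
Qed.

Lemma inv2_alpha1 c g : c.1 = @alpha1 p eta R g -> inv2 c = g.
Proof.
move=> c1; rewrite /inv2 -[RHS]mulr1 -red1 /red -(sum_carry N_gt1) rmorph_sum mulr_sumr.
by apply: eq_bigr => x _; rewrite c1 alphaE.
Qed.

Lemma inv1_cob (t : {ffun H -> R}) : t 0 = 0 -> inv1 (cob t) = (1 - om) * t 1.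
Proof.
move=> t0; rewrite /inv1 cob2.
have tele n : \sum_(i < n) (cob t).1 (i%:R, 1) = n%:R * t 1 - t n%:R.
  elim: n => [|n IHn]; first by rewrite big_ord0 t0 mul0r subr0.
  by rewrite big_ord_recr /= IHn cob1 !natr1 -natr1; ring.
rewrite tele natr_Zp -lft_natr -/(red _) red_dot red1 ppow1.
by ring.
Qed.

Lemma inv2_cob t : inv2 (cob t) = 0.
Proof.
rewrite /inv2; under eq_bigr do rewrite cob1.
rewrite big_split sumrB sum_const /= addr0.
by rewrite -(reindex_inj (addIr 1) (P := xpredT) (F := t)) subrr.
Qed.

(** A discrete primitive of beta(_, 1), whose coboundary agrees with beta on the pairs (x, 1) except
    where x + 1 wraps around. *)
Definition trivializer (c : cochains H R) : {ffun H -> R} :=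
  [ffun x : H => - \sum_(i < x) c.1 (i%:R, 1)].

Lemma trivializer0 c : trivializer c 0 = 0.
Proof. by rewrite ffunE big_ord0 oppr0. Qed.

Lemma trivializer1 c : cocycle_eqs c -> trivializer c 1 = 0.
Proof.
case=> _ c10l _ _ _ _ _ _; rewrite ffunE.
by rewrite (Zp1_val N_gt1) big_ord1 c10l oppr0.
Qed.

Lemma trivializerP c x : trivializer c x - trivializer c (x + 1) =
  c.1 (x, 1) - inv2 c * (carry x 1)%:~R.
Proof.
have sumS : \sum_(i < x.+1) c.1 (i%:R, 1) = \sum_(i < x) c.1 (i%:R, 1) + c.1 (x, 1).
  by rewrite big_ord_recr /= natr_Zp.
rewrite !ffunE opprK addrC; have [xN|xN] := ltnP x.+1 N.
  have := carry1_small xN; rewrite natr_Zp => ->; rewrite mulr0 subr0.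
  have -> : ((x + 1 : H)%R : nat) = x.+1.
    by rewrite -[x in LHS]natr_Zp natr1 val_Zp_nat // modn_small.
  by rewrite sumS addrAC subrr add0r.
(* At the last element the primitive jumps back to 0, and the defect is the full sum [inv2 c],
   matched by the only nonzero carry. *)
have xE : x.+1 = N by apply/eqP; rewrite eqn_leq xN lft_lt.
have x10 : x + 1 = 0 by rewrite -[x in LHS]natr_Zp natr1 xE ZpN0.
have -> : carry x 1 = 1.
  apply: (mulIf (N_neq0 N_gt1)); rewrite carryE // x10 lft0 lft1 // subr0 mul1r.
  by rewrite -PoszD addn1 xE.
have inv2E : inv2 c = \sum_(i < x.+1) c.1 (i%:R, 1).
  rewrite xE -(sum_Zp N_gt1 (fun i => c.1 (i%:R, 1))).
  by apply: eq_bigr => i _; rewrite natr_Zp.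
by rewrite x10 big_ord0 inv2E sumS; ring.
Qed.

(** Let F be the difference of the two sides at (x, _). F vanishes at 0, and the cocycle identity at
    (x, z, 1), where the pairs ending in 1 are settled by [trivializerP], gives F(z + 1) = F(z). *)
Lemma trivializer_alpha1 c : cocycle_eqs c ->
  (c - cob (trivializer c)).1 = @alpha1 p eta R (inv2 c).
Proof.
move=> cc; have t1 := trivializer1 cc; case: cc => c10 _ _ _ _ cA _ _.
apply/ffunP=> -[x y]; rewrite alphaE cochD1 cochN1; apply/subr0_eq.
set t := trivializer c in t1 *; set g := inv2 c.
pose F y := c.1 (x, y) - (cob t).1 (x, y) - g * (carry x y)%:~R.
have FS z : F (z + 1) = F z.
  have := cA x z 1; rewrite -[c.1 (z, 1)](subrK (g * (carry z 1)%:~R)) -trivializerP.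
  rewrite -[c.1 (x + z, 1)](subrK (g * (carry (x + z) 1)%:~R)) -trivializerP -/t.
  have := congr1 (fun n : int => g * n%:~R) (carry_cocycle x z 1).
  rewrite !(rmorphB, rmorphD) /= mulr0 => gA E.
  rewrite /F !cob1; apply/subr0_eq.
  have := congr2 (fun u v : R => u - v) E gA; rewrite subr0 => <-.
  by rewrite (addrA x z 1); ring.
rewrite -/(F y) -(natr_Zp y); elim: (y : nat) => [|n IHn].
  by rewrite /F c10 cob1 carry0 addr0 /t trivializer0; ring.
by rewrite -natr1 FS.
Qed.

Lemma cocycle_decomp c : is_2cocycle dot dia prec c ->
  c = cob (trivializer c) + rep (inv1 c) (inv2 c).
Proof.
move=> cc; have /cocycleP cc' := cc; set t := trivializer c.
have c't : is_2cocycle dot dia prec (c - cob t).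
  by apply/cocycleD/cocycleN/cob_cocycle => //; apply: trivializer0.
apply/eqP; rewrite addrC -subr_eq; apply/eqP.
have c1 := trivializer_alpha1 cc'.
rewrite (normalized_eq (cocycleP _ c't) c1) -(inv1_alpha1 c1) /rep.
suff -> : inv1 (c - cob t) = inv1 c by [].
have := inv1D (c - cob t) (cob t); rewrite subrK inv1_cob ?trivializer0 //.
by rewrite (trivializer1 cc') mulr0 addr0.
Qed.

Lemma inv2_fixed c : is_2cocycle dot dia prec c ->
  al * inv2 c = inv2 c /\ be * inv2 c = 0.
Proof.
move=> cc; have /cocycleP cc' := cc; have c1 := trivializer_alpha1 cc'.
have c't : is_2cocycle dot dia prec (c - cob (trivializer c)).
  by apply/cocycleD/cocycleN/cob_cocycle => //; apply: trivializer0.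
have c1E x y : (c - cob (trivializer c)).1 (x, y) = inv2 c * (carry x y)%:~R.
  by rewrite c1 alphaE.
by split; [apply: cocycle_al c1E|apply: cocycle_be c1E]; apply/cocycleP.
Qed.

(** The parameter is the one for which [canon] takes the value [f0] at (1, 1); [normalized_eq] then
    identifies the two. This is how [rep] is seen to be a cocycle. *)
Lemma canon_rep f0 g : al * g = g -> be * g = 0 ->
  canon (f0 + M%:R * g + g * (wrap 1 1)%:~R) g = rep f0 g.
Proof.
move=> ag bg; set c := canon _ g.
rewrite [LHS](@normalized_eq c g) //; last exact/cocycleP/canon_cocycle.
rewrite canonE red1 [geo _](_ : _ = 1); first by congr rep; ring.
by rewrite (Zp1_val N_gt1) /geo big_ord1 expr0.
Qed.

Lemma rep_cocycle f0 g : al * g = g -> be * g = 0 -> is_2cocycle dot dia prec (rep f0 g).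
Proof. by move=> ag bg; rewrite -canon_rep //; apply: canon_cocycle. Qed.

Lemma inv2_rep f0 g : inv2 (rep f0 g) = g.
Proof. exact: inv2_alpha1. Qed.

Lemma inv1_rep f0 g : al * g = g -> be * g = 0 -> inv1 (rep f0 g) = f0.
Proof.
move=> ag bg; rewrite -canon_rep // (@inv1_alpha1 _ g) // canonE red1.
by rewrite (Zp1_val N_gt1) /geo big_ord1 expr0; ring.
Qed.

Lemma rep_coboundary tau : cob [ffun x => red x * tau] = rep ((1 - om) * tau) 0.
Proof.
set t := [ffun _ => _]; have t0 : t 0 = 0 by rewrite ffunE red0 mul0r.
have c1 : (cob t).1 = @alpha1 p eta R 0.
  apply/ffunP=> -[x y]; rewrite alphaE mul0r cob1 !ffunE redD; ring.
rewrite [LHS](normalized_eq (cocycleP _ (cob_cocycle t0)) c1) -(inv1_alpha1 c1).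
by rewrite inv1_cob // ffunE red1 mul1r.
Qed.

Lemma coboundary_inv c : is_2cocycle dot dia prec c ->
  reflect (exists2 tau, inv1 c = (1 - om) * tau & inv2 c = 0) (is_coboundary dot dia prec c).
Proof.
move=> cc; apply: (iffP (coboundaryP c)) => [[t t0 ->]|[tau c1 c2]].
  by exists (t 1); [apply: inv1_cob|apply: inv2_cob].
(* The [trivializer] reduces [c] to [rep], and the homomorphism given by [tau] absorbs what remains
   of [inv1]. *)
exists (trivializer c + [ffun x => red x * tau]).
  by rewrite !ffunE big_ord0 red0 mul0r oppr0 addr0.
rewrite [LHS](cocycle_decomp cc) c1 c2 -rep_coboundary.
congr (_, _); apply/ffunP=> -[x y]; rewrite !ffunE /=.
  by ring.
by ring.
Qed.

Definition fixed (g : R) : bool := (al * g == g) && (be * g == 0).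

Lemma fixedP g : reflect (al * g = g /\ be * g = 0) (fixed g).
Proof. by apply: (iffP andP) => -[/eqP ? /eqP ?]. Qed.

(** * The cohomology group and its classes through the two invariants *)

Section Quotient.
Variables m q : nat.
Hypothesis multP : forall x : R, reflect (exists tau, x = (1 - om) * tau) (x \in multiples R m).
Hypothesis mult_fixed : forall g : R, (g \in multiples R q) = fixed g.

Local Notation Z2 := (cocycles dot dia prec).
Local Notation B2 := (coboundaries dot dia prec).

Lemma mem_coboundaries c : is_2cocycle dot dia prec c ->
  (c \in B2) = (inv1 c \in multiples R m) && (inv2 c == 0).
Proof.
move=> cc; rewrite inE; apply/(coboundary_inv cc)/andP => [[tau c1 c2]|[/multP[tau c1] /eqP c2]].
  by rewrite c2 eqxx; split=> //; apply/multP; exists tau.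
by exists tau.
Qed.

Lemma sub_coboundaries : B2 \subset Z2.
Proof.
apply/subsetP => c; rewrite !inE => /coboundaryP[t t0 ->]; exact: cob_cocycle.
Qed.

Definition classify (c : cochains H R) : coset_of (multiples R m) * R :=
  (coset (multiples R m) (inv1 c), inv2 c).

Lemma classifyM : {in Z2 &, {morph classify : c d / (c * d)%g}}.
Proof.
move=> c d _ _; rewrite /classify -[inv1 _]/(inv1 (c + d)) -[inv2 _]/(inv2 (c + d)).
by rewrite inv1D inv2D; congr (_, _); apply: morphM; apply: zmod_norm.
Qed.
Canonical classify_morphism := Morphism classifyM.

Lemma ker_classify : ('ker classify)%g = B2.
Proof.
apply/setP => c; apply/idP/idP => [/morphpreP[]|cB].
  rewrite inE => cc; rewrite inE => /eqP[] c1 c2.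
  rewrite mem_coboundaries // c2 eqxx andbT.
  exact: coset_idr (zmod_norm _ _) c1.
have cc : c \in Z2 by apply: (subsetP sub_coboundaries).
move: cB; rewrite mem_coboundaries; last by rewrite inE in cc.
case/andP=> c1 /eqP c2; apply/kerP => //=.
by rewrite /classify c2 coset_id.
Qed.

(** Every pair of invariants with fixed second entry is attained by the cocycle [rep]. *)
Lemma im_classify : (classify @* Z2 = setX ([set: R] / multiples R m) (multiples R q))%g.
Proof.
apply/setP => -[x g]; apply/morphimP/setXP => /= [[c _ cZ [-> ->]]|[/morphimP[f0 _ _ ->] gq]].
  split; first exact/mem_quotient/in_setT.
  by rewrite mult_fixed; apply/fixedP/inv2_fixed; rewrite inE in cZ.
have /fixedP[ag bg] : fixed g by rewrite -mult_fixed.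
exists (rep f0 g); rewrite ?inE ?rep_cocycle //.
by rewrite /classify /= inv1_rep // inv2_rep.
Qed.

Lemma H2_isog :
  H2 dot dia prec \isog setX ([set: R] / multiples R m)%g (multiples R q).
Proof. by rewrite -im_classify; have := first_isog classify_morphism; rewrite ker_classify. Qed.

Lemma mem_class c f0 g : is_2cocycle dot dia prec c -> fixed g ->
  (rep f0 g \in (coset B2 c : {set cochains H R})) =
  (f0 - inv1 c \in multiples R m) && (g == inv2 c).
Proof.
move=> cc /fixedP[ag bg]; rewrite val_coset ?zmod_norm // mem_rcoset.
rewrite -[(_ * _)%g]/(rep f0 g - c) mem_coboundaries; last first.
  by apply/cocycleD/cocycleN => //; apply: rep_cocycle.
have invN (i : cochains H R -> R) : {morph i : x y / x + y} -> i (- c) = - i c.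
  move=> iD; have i0 : i 0 = 0 by apply: (addrI (i 0)); rewrite -iD !addr0.
  by apply: (addrI (i c)); rewrite -iD !subrr.
rewrite inv1D inv2D (invN inv1 inv1D) (invN inv2 inv2D) inv1_rep // inv2_rep.
by rewrite subr_eq0.
Qed.

Lemma representatives (Lambda : {set R * R}) :
  (forall l, l \in Lambda -> fixed l.2) ->
  (forall x g, fixed g ->
    exists! l, [/\ l \in Lambda, l.1 - x \in multiples R m & l.2 = g]) ->
  complete_representatives nu A B dia prec Lambda.
Proof.
move=> Lfix Luniq; split=> [f0 g /Lfix /fixedP[ag bg]|C /morphimP[c _ cZ ->]].
  split; last exact: rep_cocycle.
  (* Both sides of the condition vanish: [N] and [P] are 0 in [R], and a g = g. *)
  rewrite /admissible AE ag -mulr_natr natr_N0 mulr0 eq_sym subr_eq0 mulrnDr -mulr_natr.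
  by rewrite natrB ?leq_exp2l ?prime_gt1 // natr_N0 P0 subrr mulr0 add0r.
rewrite inE in cZ.
have cfix : fixed (inv2 c) by apply/fixedP/inv2_fixed.
have [l [[lL l1 l2] lU]] := Luniq (inv1 c) _ cfix.
exists l; split=> [|l' [l'L]].
  by split=> //; rewrite mem_class ?Lfix // l1 l2 eqxx.
by rewrite mem_class ?Lfix // => /andP[l'1 /eqP l'2]; apply: lU.
Qed.

End Quotient.
End Cocycles.

End LinearCycleSet.

(** * Divisibility by powers of p *)

Lemma sum_expn_mul w m n :
  (\sum_(i < m * n) w ^ i = (\sum_(i < m) w ^ i) * \sum_(j < n) (w ^ m) ^ j)%N.
Proof.
elim: n => [|n IHn]; first by rewrite muln0 !big_ord0 muln0.
rewrite mulnS addnC big_split_ord IHn big_ord_recr mulnDr -expnM /=; congr (_ + _)%N.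
by rewrite big_distrl /=; apply: eq_bigr => i _; rewrite expnD mulnC.
Qed.

(** By [sum_expn_mul], each step multiplies the sum by [p] terms that are all 1 modulo [p]. *)
Lemma dvdn_sum_expn p w n : w = 1 %[mod p] -> (p ^ n %| \sum_(i < p ^ n) w ^ i)%N.
Proof.
move=> w1; elim: n => [|n IHn]; first exact: dvd1n.
rewrite !expnSr sum_expn_mul dvdn_mul //.
rewrite /dvdn -modn_summ; under eq_bigr => j _.
  rewrite -expnM -modnXm w1 modnXm exp1n.
over.
by rewrite modn_summ sum1_card card_ord modnn.
Qed.

Section ModPrimePower.
Variables p r : nat.
Hypotheses (p_prime : prime p) (r_ge1 : (1 <= r)%N).
Local Notation R := 'Z_(p ^ r).

Let pr_gt1 : (1 < p ^ r)%N.
Proof. by rewrite -{1}(expn0 p) ltn_exp2l ?prime_gt1. Qed.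

Lemma natr_Zpr_eq0 n : (n%:R == 0 :> R) = (p ^ r %| n)%N.
Proof. by rewrite /dvdn -(val_Zp_nat pr_gt1). Qed.

Lemma mem_multiples (x : R) j : (j <= r)%N ->
  (x \in multiples R (p ^ j)) = (p ^ j %| x)%N.
Proof.
move=> jr; apply/imsetP/dvdnP => [[y _ ->]|[t xE]].
  apply/dvdnP; rewrite -(natr_Zp y) -mulrnA val_Zp_nat //.
  by rewrite /dvdn modn_dvdm ?dvdn_exp2l // modnMl.
by exists t%:R; rewrite // -mulrnA -xE natr_Zp.
Qed.

Lemma unit_natr n : ~~ (p %| n)%N -> (n%:R : R) \is a GRing.unit.
Proof. by move=> pn; rewrite unitZpE // coprimeXl // prime_coprime. Qed.

Lemma multiples_unit (c x : R) n : c \is a GRing.unit ->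
  reflect (exists tau, x = c *+ n * tau) (x \in multiples R n).
Proof.
move=> uc; apply: (iffP imsetP) => [[y _ ->]|[tau ->]].
  by exists (c^-1 * y); rewrite mulrnAl mulrA divrr // mul1r.
by exists (c * tau); rewrite // mulrnAl.
Qed.

(** The conclusion is an equality in [R]: when [j] exceeds [r], as may happen for [t2], the
    multiples of [p ^ j] are trivial but distinct [n] and [m] can have the same image. *)
Lemma natr_sub_multiples n m j : (n < p ^ j)%N -> (m < p ^ j)%N ->
  n%:R - m%:R \in multiples R (p ^ j) -> n%:R = m%:R :> R.
Proof.
move=> nj mj; have [jr|rj] := leqP j r; last first.
  case/imsetP=> y _ /eqP; rewrite subr_eq => /eqP->.
  rewrite -(mulr_natr y) (_ : (p ^ j)%:R = 0) ?mulr0 ?add0r //.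
  by apply/eqP; rewrite natr_Zpr_eq0 dvdn_exp2l // ltnW.
case/imsetP=> y _ /eqP; rewrite subr_eq -(natr_Zp y) -mulrnA -natrD => /eqP.
move/(congr1 (fun x : R => (x : nat) %% p ^ j)%N); rewrite !val_Zp_nat //.
rewrite !modn_dvdm ?dvdn_exp2l // modnMDl !modn_small //.
by move->.
Qed.

End ModPrimePower.

(** The number is a (1 + b) - 1, and [t2] is its valuation. If the valuations [u.+1] of k p and [s]
    of b differ, the smaller one wins; if they agree, p^s splits off and leaves v + d + p^s v d. *)
Lemma valuation_factor p k u v b s d :
  prime p -> (0 < k)%N -> k = (p ^ u * v)%N -> ~~ (p %| v)%N ->
  (b = 0 \/ [/\ b = p ^ s * d, ~~ (p %| d) & 0 < s])%N ->
  exists2 m, ~~ (p %| m)%N & (k * p + b + k * p * b = m * p ^ t2_of p b u v s d)%N.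
Proof.
move=> p_pr k_gt0 -> pv; have vN0 : (0 < v)%N by case: v pv => //; rewrite dvdn0.
case=> [->|[-> pd s_gt0]]; rewrite /t2_of /t1_of /=.
  by exists v => //; rewrite muln0 !addn0 expnS; ring.
have dN0 : (0 < d)%N by case: d pd => //; rewrite dvdn0.
have -> : (p ^ s * d == 0)%N = false.
  by apply/negbTE; rewrite -lt0n muln_gt0 expn_gt0 prime_gt0.
have addp_ndvd x y : ~~ (p %| x)%N -> (p %| y)%N -> ~~ (p %| x + y)%N.
  by move=> px py; rewrite dvdn_addl.
have [su|su|us] := ltngtP s u.+1; rewrite /=.
- exists (d + p ^ (u.+1 - s) * v * (1 + p ^ s * d))%N.
    by apply: addp_ndvd => //; rewrite -mulnA dvdn_mulr // dvdn_exp // subn_gt0.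
  have -> : (p ^ u * v * p = p ^ (u.+1 - s) * p ^ s * v)%N.
    by rewrite -expnD subnK ?(ltnW su) // expnS; ring.
  by ring.
- exists (v + (p ^ (s - u.+1) * d + p ^ s * v * d))%N.
    apply: addp_ndvd => //; apply: dvdn_add; first by rewrite dvdn_mulr // dvdn_exp // subn_gt0.
    by rewrite -mulnA dvdn_mulr // dvdn_exp.
  have -> : (p ^ s = p ^ (s - u.+1) * p ^ u.+1)%N by rewrite -expnD subnK // ltnW.
  by rewrite expnS; ring.
have gt0 : (0 < v + d + p ^ s * v * d)%N by rewrite -addnA ltn_addr.
have [m cop mE] := pfactor_coprime p_pr gt0.
exists m; first by rewrite -prime_coprime.
by rewrite expnD (mulnCA m) -mE us expnS; ring.
Qed.

(** * Homotheties of Z/p^r: the hypotheses on coefficients and the exponents [t1], [t2] *)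

Section HomothetyData.
Variables p nu eta r a k u v b s d : nat.
Hypotheses (p_prime : prime p) (p_odd : odd p).
Hypotheses (nu_gt0 : (0 < nu)%N) (le_nu_eta : (nu <= eta)%N).
Hypothesis le_eta_2nu : (eta <= 2 * nu)%N.
Hypotheses (r_ge1 : (1 <= r)%N) (le_r_nu : (r <= nu)%N).
Hypothesis aE : a = (1 + k * p)%N.
Hypotheses (k_gt0 : (0 < k)%N) (k_lt : (k < p ^ (r - 1))%N).
Hypotheses (kE : k = (p ^ u * v)%N) (p_ndvd_v : ~~ (p %| v)%N).
Hypothesis bE : b = 0%N \/
  [/\ b = (p ^ s * d)%N, ~~ (p %| d)%N, (s < r)%N & (r <= 2 * s)%N].

Local Notation R := 'Z_(p ^ r).
Local Notation t1 := (t1_of b u s).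
Local Notation t2 := (t2_of p b u v s d).

Let p_gt0 : (0 < p)%N. Proof. exact: prime_gt0. Qed.
Let p_gt1 : (1 < p)%N. Proof. exact: prime_gt1. Qed.
Let pr_gt1 : (1 < p ^ r)%N.
Proof. by rewrite -{1}(expn0 p) ltn_exp2l. Qed.

Let eq0 n : (n%:R == 0 :> R) = (p ^ r %| n)%N.
Proof. exact: natr_Zpr_eq0. Qed.

Lemma b_valuation : (b = 0 \/ [/\ b = p ^ s * d, ~~ (p %| d) & 0 < s])%N.
Proof.
case: bE => [|[? ? sr rs]]; [by left|right; split=> //].
by case: (s) sr rs => // _; rewrite leqNgt r_ge1.
Qed.

Lemma natr_P0 : (p ^ nu)%:R = 0 :> R.
Proof. by apply/eqP; rewrite eq0 dvdn_exp2l. Qed.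

Lemma natr_b_sqr : (b%:R : R) * b%:R = 0.
Proof.
apply/eqP; rewrite -natrM eq0; case: bE => [->|[-> _ _ rs]]; first by rewrite mul0n dvdn0.
by rewrite mulnACA -expnD addnn -mul2n dvdn_mulr // dvdn_exp2l.
Qed.

Lemma dvdn_p_b : (p %| b)%N.
Proof.
by case: b_valuation => [->|[-> _ s_gt0]]; rewrite ?dvdn0 // dvdn_mulr // dvdn_exp.
Qed.

(** a (1 + b) is 1 modulo [p], so the sum is divisible by [p ^ nu], hence by [p ^ r]. *)
Lemma sum_om : \sum_(i < p ^ nu) (a%:R * (1 + b%:R) : R) ^+ i = 0.
Proof.
have -> : \sum_(i < p ^ nu) (a%:R * (1 + b%:R) : R) ^+ i =
          (\sum_(i < p ^ nu) (a * (1 + b)) ^ i)%N%:R.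
  by rewrite natr_sum; apply: eq_bigr => i _; rewrite natrX natrM natrD.
apply/eqP; rewrite eq0; apply: dvdn_trans (dvdn_exp2l p le_r_nu) (dvdn_sum_expn _ _).
by rewrite -modnMm -[((1 + b) %% p)%N]modnDmr (eqP dvdn_p_b) addn0 aE addnC modnMDl modnMm.
Qed.

Lemma mulr2_inj (x : R) : x *+ 2 = 0 -> x = 0.
Proof.
rewrite -[x](natr_Zp x) -mulrnA => /eqP; rewrite eq0 Gauss_dvdl; last first.
  by rewrite coprimeXl // coprimen2.
by rewrite -eq0 => /eqP.
Qed.

(** 1 - a (1 + b) is p^t2 times a unit, by [valuation_factor]. *)
Lemma multiples_t2 (x : R) :
  reflect (exists tau, x = (1 - a%:R * (1 + b%:R)) * tau) (x \in multiples R (p ^ t2)).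
Proof.
apply: (equivP idP); have [m pm mE] := valuation_factor p_prime k_gt0 kE p_ndvd_v b_valuation.
have -> : 1 - a%:R * (1 + b%:R) = (- m%:R : R) *+ p ^ t2.
  by rewrite mulNrn -mulrnA -mE aE !(natrD, natrM); ring.
have uN : - m%:R \is a @GRing.unit R by rewrite unitrN unit_natr.
by split=> /(multiples_unit _ _ uN).
Qed.

Lemma u_lt : (u.+1 <= r)%N.
Proof.
have : (p ^ u < p ^ (r - 1))%N.
  apply: leq_ltn_trans k_lt; rewrite kE leq_pmulr //.
  by case: (v) p_ndvd_v => //; rewrite dvdn0.
by rewrite ltn_exp2l // ltn_subRL add1n => /ltnW.
Qed.

Lemma t1_le : (t1 <= r)%N.
Proof. by rewrite /t1_of; case: ifP => _; rewrite ?geq_min u_lt. Qed.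

(** Up to factors prime to [p], the two conditions say that p^(u+1) g and, for nonzero b, p^s g
    vanish; the one with the smaller exponent implies the other. *)
Lemma multiples_t1 (g : R) : (g \in multiples R (p ^ (r - t1))) = fixed a b g.
Proof.
rewrite mem_multiples ?leq_subr // /fixed.
have -> : (a%:R * g == g) = (p ^ r %| p ^ u.+1 * g)%N.
  rewrite aE natrD mulrDl mul1r -[X in _ == X]addr0 (inj_eq (addrI g)).
  rewrite -{1}[g]natr_Zp -natrM eq0 kE expnSr.
  rewrite (_ : p ^ u * v * p * g = v * (p ^ u * p * g))%N; last by ring.
  by rewrite Gauss_dvdr // coprimeXl // prime_coprime.
have -> : (b%:R * g == 0) = ((b == 0) || (p ^ r %| p ^ s * g))%N.
  rewrite -{1}[g]natr_Zp -natrM eq0; case: bE => [->|[-> pd _ _]].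
    by rewrite mul0n dvdn0.
  have d_gt0 : (0 < d)%N by case: (d) pd => //; rewrite dvdn0.
  rewrite muln_eq0 (gtn_eqF d_gt0) expn_eq0 (gtn_eqF p_gt0) /=.
  rewrite (_ : p ^ s * d * g = d * (p ^ s * g))%N; last by ring.
  by rewrite Gauss_dvdr // coprimeXl // prime_coprime.
have dvd_sub t : (t <= r)%N -> (p ^ r %| p ^ t * g)%N = (p ^ (r - t) %| g)%N.
  by move=> tr; rewrite -{1}(subnKC tr) expnD dvdn_pmul2l ?expn_gt0 ?p_gt0.
rewrite -dvd_sub ?t1_le // /t1_of; case: ifP => [_|b0]; first by rewrite andbT.
have [le_us|lt_su] := leqP u.+1 s.
  apply/idP/andP => [div|[]//]; split=> //.
  by apply: dvdn_trans div _; rewrite dvdn_mul // dvdn_exp2l.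
apply/idP/andP => [div|[]//]; split=> //.
by apply: dvdn_trans div _; rewrite dvdn_mul // dvdn_exp2l // ltnW.
Qed.

Let Lambda : {set R * R} := [set ((z.1 : nat)%:R, (p ^ (r - t1) * z.2)%:R)
   | z : 'I_(p ^ t2) * 'I_(p ^ t1)].

Lemma LambdaP (l : R * R) : reflect
  (exists2 z1 : 'I_(p ^ t2), l.1 = (z1 : nat)%:R & l.2 \in multiples R (p ^ (r - t1)))
  (l \in Lambda).
Proof.
apply: (iffP imsetP) => [[z _ ->]|[z1 l1 l2]].
  by exists z.1 => //=; apply/imsetP; exists (z.2 : nat)%:R; rewrite // -mulrnA mulnC.
move: l2; rewrite mem_multiples ?leq_subr // => /dvdnP[n nE].
have n_lt : (n < p ^ t1)%N.
  rewrite -(ltn_pmul2r (m := p ^ (r - t1))) ?expn_gt0 ?p_gt0 // -nE -expnD subnKC ?t1_le //.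
  by rewrite lft_lt.
exists (z1, Ordinal n_lt) => //=.
by rewrite [l]surjective_pairing l1 mulnC -nE natr_Zp.
Qed.

(** The first coordinate is the remainder of the representative of [x] modulo p^t2, and the second
    is forced. *)
Lemma Lambda_unique (x g : R) : fixed a b g ->
  exists! l, [/\ l \in Lambda, l.1 - x \in multiples R (p ^ t2) & l.2 = g].
Proof.
rewrite -multiples_t1 => gq; have pt2 : (0 < p ^ t2)%N by rewrite expn_gt0 p_gt0.
pose z := (x %% p ^ t2)%N; have zx : z%:R - x \in multiples R (p ^ t2).
  apply/imsetP; exists (- (x %/ p ^ t2)%N%:R) => //.
  apply/eqP; rewrite subr_eq mulNrn -mulrnA addrC eq_sym subr_eq addrC -natrD.
  by rewrite -divn_eq natr_Zp.
exists (z%:R, g); split=> [|[y1 y2] [/LambdaP[z1 /= -> _] z1x ->]].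
  by split=> //; apply/LambdaP; exists (Ordinal (ltn_pmod x pt2)).
congr (_, _); apply: (@natr_sub_multiples p r p_prime r_ge1 _ _ t2); rewrite ?ltn_pmod //.
have := groupM zx (groupVr z1x); rewrite -[(_ * _)%g]/(z%:R - x - (z1%:R - x)).
by rewrite opprB addrA subrK.
Qed.

End HomothetyData.

Theorem proposition4p9 (p nu eta r a k u v b s d : nat)
    (p_prime : prime p) (p_odd : odd p)
    (nu_gt0 : (0 < nu)%N) (le_nu_eta : (nu <= eta)%N)
    (le_eta_2nu : (eta <= 2 * nu)%N)
    (r_ge1 : (1 <= r)%N) (le_r_nu : (r <= nu)%N)
    (aE : a = (1 + k * p)%N)
    (k_gt0 : (0 < k)%N) (k_lt : (k < p ^ (r - 1))%N)
    (kE : k = (p ^ u * v)%N) (p_ndvd_v : ~~ (p %| v)%N)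
    (b_lt : (b < p ^ r)%N)
    (bE : b = 0%N \/
          [/\ b = (p ^ s * d)%N, ~~ (p %| d)%N, (s < r)%N & (r <= 2 * s)%N]) :
  let A : {additive 'Z_(p ^ r) -> 'Z_(p ^ r)} := homothety a in
  let B : {additive 'Z_(p ^ r) -> 'Z_(p ^ r)} := homothety b in
  let dia (h : 'Z_(p ^ eta)) : {additive 'Z_(p ^ r) -> 'Z_(p ^ r)} := homothety (a ^ h) in
  let prec (h : 'Z_(p ^ eta)) : {additive 'Z_(p ^ r) -> 'Z_(p ^ r)} := homothety (h * b) in
  let t1 := t1_of b u s in
  let t2 := t2_of p b u v s d in
  (H2 (lcs_dot nu (eta := eta)) dia prec \isog
     setX ([set: 'Z_(p ^ r)] / multiples 'Z_(p ^ r) (p ^ t2))%g (multiples 'Z_(p ^ r) (p ^ (r - t1)))) /\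
  complete_representatives nu A B dia prec
    [set ((z.1 : nat)%:R, (p ^ (r - t1) * z.2)%:R)
       | z : 'I_(p ^ t2) * 'I_(p ^ t1)].
Proof.
move=> A B dia prec t1 t2.
have P0 := natr_P0 p_prime r_ge1 le_r_nu.
have be2 := natr_b_sqr p_prime r_ge1 bE.
have om0 := sum_om p_prime r_ge1 le_r_nu aE bE.
have two := @mulr2_inj _ _ p_prime p_odd r_ge1.
have multP := multiples_t2 p_prime r_ge1 aE k_gt0 kE p_ndvd_v bE.
have fixE := multiples_t1 p_prime r_ge1 aE k_lt kE p_ndvd_v bE.
split.
  exact: (H2_isog p_prime p_odd nu_gt0 le_nu_eta le_eta_2nu P0 be2 om0 two multP fixE).
apply: (representatives p_prime p_odd nu_gt0 le_nu_eta le_eta_2nu P0 be2 om0 two multP).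
  by move=> l /(LambdaP b s d p_prime r_ge1 k_lt kE p_ndvd_v)[_ _]; rewrite fixE.
exact: (Lambda_unique p_prime r_ge1 aE k_lt kE p_ndvd_v bE).
Qed.
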